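(* For each cardinal $\kappa$ with $\kappa\notin\{2,4\}$ and $\kappa\leq 2^{\aleph_0}$, there exists a semirigid system of three equivalence relations on a set of cardinality $\kappa$.
   Context: A map $f:E\to E$ preserves an equivalence relation $\rho$ on $E$ if $(x,y)\in\rho$ implies $(f(x),f(y))\in\rho$. A system of equivalence relations on $E$ is semirigid if the only self-maps $f:E\to E$ preserving every relation of the system are the identity map and the constant maps. *)

(* Defs.v *)
From mathcomp Require Import all_boot.
From mathcomp Require Import boolp classical_sets functions cardinality.
From Corelib Require Import RelationClasses.

Set Implicit Arguments.
Unset Strict Implicit.
Unset Printing Implicit Defensive.

Definition preserves (E : Type) (f : E -> E) (rho : E -> E -> Prop) : Prop :=
  forall x y : E, rho x y -> rho (f x) (f y).

(* A system is an indexed family: repetitions are allowed, since a set with at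
   most one element carries only one equivalence relation. *)
Definition equivalence_system (I E : Type) (rho : I -> E -> E -> Prop) : Prop :=
  forall i : I, Equivalence (rho i).

(* On the empty type the only self-map is the identity; no constant is
   available there. *)
Definition semirigid (I E : Type) (rho : I -> E -> E -> Prop) : Prop :=
  forall f : E -> E, (forall i : I, preserves f (rho i)) ->
    f = id \/ exists c : E, f = (fun _ : E => c).

(* Main.v *)
From Stdlib Require Import Reals Lra Lia.
Require Import Defs.
From mathcomp Require Import all_boot ssrZ.
From mathcomp Require Import boolp classical_sets functions cardinality.

Local Open Scope classical_set_scope.
Local Open Scope card_scope.

(** Take E in the real plane with the relations "same abscissa", "same ordinate"
    and "same coordinate sum".  A map preserving them acts on a chain of adjacent
    triangles as a homothety p |-> t + l p, so E has to be chosen such that the only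
    homotheties mapping E into itself have l = 0 or are the identity.  For n = 3 a
    triangle works, for finite n >= 5 a strip of triangles with one extra point.
    For an infinite cardinal, choose a set S of reals in (0, 1) of that
    cardinality and add to the infinite strip N x {0, 1} all points of the unit
    triangle with coordinates in Z + Z s for some s in S.  There the map is
    additive, and bounded because ordinates in E lie in [0, 1], hence still
    a homothety.  The far end of the strip, where E contains only integral
    points, forces l = 1, and the non-integral points near the origin then exclude
    translations. *)

(** * Cardinal arithmetic of infinite types *)

Lemma card_leT_injP (T U : Type) (B : set U) :
  [set: T] #<= B <-> exists2 g : T -> U, injective g & forall x, B (g x).
Proof.
split=> [/card_leP[g]|[g ginj gB]].
  pose h x := g (SigSub (mem_set (I : [set: T] x))).
  exists (fun x => val (h x)) => [x y /val_inj|x]; last exact: set_valP.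
  by move=> /(@inj _ _ _ g); rewrite !inE => /(_ I I) [].
apply/card_leP/injfunPex; exists (fun x => SigSub (mem_set (gB (val x)))) => //.
by move=> x y _ _ [] /ginj /val_inj.
Qed.

(* A maximal family of pairwise disjoint injective sequences covers K up to a
   finite set, which can be interleaved with one of the sequences. *)
Lemma infinite_prod_nat_le (K : Type) :
  infinite_set [set: K] -> [set: K * nat] #<= [set: K].
Proof.
move=> Kinf; pose F (u : nat -> K) := range u.
have [D [DB trD maxD]] :=
  ex_maximal_disjoint_subcollection F [set u : nat -> K | injective u].
pose U := \bigcup_(u in D) range u.
have finR : finite_set (~` U).
  apply: contrapT => /infiniteP /card_leT_injP [g ginj gU].
  have gD : ~ D g by move=> Dg; apply: (gU 0); exists g => //; exists 0.
  apply: (maxD (D `|` [set g])).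
  - split=> [|sub]; first exact: subsetUl.
    by apply: gD; apply: sub; right.
  - by move=> u [/DB//|->].
  - move=> u v [Du|->] [Dv|->] //.
    + exact: trD.
    + by move=> [x [[a _ <-] [b _ e]]]; case: (gU b); exists u => //; exists a.
    + by move=> [x [[b _ e] [a _ ea]]]; case: (gU b); exists v => //; exists a; rewrite // ea.
have [u0 Du0] : D !=set0.
  apply: contrapT => /set0P/negP/negPn/eqP D0; apply: Kinf.
  by apply: sub_finite_set finR => x _ [u]; rewrite D0.
have /countable_injP [r rinj] := finite_set_countable finR.
(* Even indices encode points lying on sequences of [D]; odd indices along [u0] receive the finitely
   many leftover points. *)
have /choice [th thP] (x : K) : exists p : (nat -> K) * nat,
    D p.1 /\ (U x /\ (exists2 n, p.1 n = x & p.2 = n.*2) \/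
              ~ U x /\ p = (u0, (r x).*2.+1)).
  have [Ux|Ux] := pselect (U x).
    case: (Ux) => u Du [n _ ux]; exists (u, n.*2); split => //; left; split=> //.
    by exists n.
  by exists (u0, (r x).*2.+1); split => //; right.
have oddne a b : a.*2 <> b.*2.+1 by move=> /(congr1 odd); rewrite /= !odd_double.
have th_inj : injective th.
  move=> x y e; have [_ hx] := thP x; have [_ hy] := thP y.
  case: hx => -[Ux hx]; case: hy => -[Uy hy].
  - case: hx => n nx en; case: hy => m my em.
    have nm : n = m by apply: double_inj; rewrite -en -em e.
    by rewrite -nx nm e.
  - by case: hx => n _; rewrite e hy => /esym /oddne.
  - by case: hy => n _; rewrite -e hx => /esym /oddne.
  - move: e; rewrite hx hy => -[/double_inj]; exact: rinj (mem_set _) (mem_set _).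
(* Disjointness recovers the sequence from a value of [J], and its injectivity then recovers the
   index. *)
pose J (p : K * nat) := (th p.1).1 (pickle ((th p.1).2, p.2)).
have Jinj : injective J.
  move=> [x m] [y n]; rewrite /J /= => e.
  have [Dx _] := thP x; have [Dy _] := thP y.
  have uv : (th x).1 = (th y).1.
    apply: (trD _ _ Dx Dy); exists (J (x, m)); split; first by eexists.
    by rewrite /J /= e; eexists.
  move: e; rewrite uv => /(DB _ Dy) /(pcan_inj pickleK) -[e ->].
  by congr pair; apply: th_inj; case: (th x) (th y) uv e => ? ? [? ?] /= -> ->.
by apply/card_leT_injP; exists J.
Qed.

Section Plane.
Local Open Scope R_scope.

(** * Real numbers coded by binary sequences *)

Lemma nat_bool_embeds_R : exists F : (nat -> bool) -> R,
  injective F /\ forall s, (0 < F s < 1).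
Proof.
(* The p s n are the partial sums of the ternary expansion with digits s. *)
pose p := fix p (s : nat -> bool) n : R := match n with
  | 0%N => 0
  | n.+1 => (p s n + if s n then (/ 3) ^ n.+1 else 0) end.
have pos n : (0 < (/ 3) ^ n) by apply: pow_lt; lra.
have mono s n k : (p s n <= p s (n + k)%N).
  elim: k => [|k ih]; first by rewrite addn0; lra.
  by rewrite addnS /=; have := pos (n + k)%N; case: (s _) => /=; lra.
have upper s n k : (p s (n + k)%N <= p s n + (/ 3) ^ n / 2 - (/ 3) ^ (n + k)%N / 2).
  elim: k => [|k ih]; first by rewrite addn0; lra.
  by rewrite addnS /=; have := pos (n + k)%N; case: (s _) => /=; lra.
have ub s : {l : R | is_lub (fun x => exists n, x = p s n) l}.
  apply: completeness; last by exists 0, 0%N.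
  exists 1 => x [n ->]; have := upper s 0%N n; rewrite add0n /=; have := pos n; lra.
pose F s := sval (ub s).
have lo s n : (p s n <= F s).
  by rewrite /F; case: (ub s) => l [ul _] /=; apply: ul; exists n.
(* The tail from digit [n] on is at most [(/ 3) ^ n / 2], so the digits after a first difference at
   [n] cannot make up for its weight [(/ 3) ^ n.+1]. *)
have hi s n : (F s <= p s n + (/ 3) ^ n / 2).
  rewrite /F; case: (ub s) => l [_ ll] /=; apply: ll => x [m ->].
  have [nm|mn] := leqP n m.
    by have := upper s n (m - n)%N; rewrite subnKC //; have := pos m; lra.
  by have := mono s m (n - m)%N; rewrite subnKC 1?ltnW //; have := pos n; lra.
(* [F s] lies in [0, 1/2]; the shift avoids the endpoint 0. *)
exists (fun s => (/ 4 + F s)); split=> [s t e|s].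
  have {}e : F s = F t by lra.
  have step n : p s n = p t n -> s n = t n.
    move=> pe; have := (lo s n.+1, hi s n.+1); have := (lo t n.+1, hi t n.+1).
    rewrite /= pe e; have := pos n.
    by case: (s n); case: (t n) => //= ? [? ?] [? ?]; exfalso; lra.
  have pst n : p s n = p t n by elim: n => //= n ih; rewrite ih step.
  by apply: funext => n; exact: step.
by have := lo s 0%N; have := hi s 0%N; rewrite /=; lra.
Qed.

(** * Rigidity of point sets in the plane *)

Definition plane_map (A : set (R * R)) (f : R * R -> R * R) : Prop :=
  [/\ forall p, A p -> A (f p),
      forall p q, A p -> A q -> p.1 = q.1 -> (f p).1 = (f q).1,
      forall p q, A p -> A q -> p.2 = q.2 -> (f p).2 = (f q).2 &
      forall p q, A p -> A q -> p.1 + p.2 = q.1 + q.2 ->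
        (f p).1 + (f p).2 = (f q).1 + (f q).2].

Definition plane_rigid (A : set (R * R)) : Prop :=
  forall f, plane_map A f ->
    (forall p, A p -> f p = p) \/ (exists2 c, A c & forall p, A p -> f p = c).

Lemma semirigid_of_plane_rigid (A : set (R * R)) : plane_rigid A ->
  exists rho : 'I_3 -> A -> A -> Prop, equivalence_system rho /\ semirigid rho.
Proof.
move=> Arigid.
pose coord (i : 'I_3) (p : R * R) :=
  match val i with 0%N => p.1 | 1%N => p.2 | _ => p.1 + p.2 end.
exists (fun i p q => coord i (val p) = coord i (val q)); split.
  by move=> i; split=> // p q r ->.
move=> f fP.
(* [plane_map] takes total maps of the plane, so [f] is extended by the identity outside [A], where
   values do not matter. *)
pose g p := if pselect (A p) is left Ap then val (f (SigSub (mem_set Ap))) else p.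
have gE (p : A) : g (val p) = val (f p).
  rewrite /g; case: pselect => [h|]; last by case; exact: set_valP.
  by congr (val (f _)); exact: val_inj.
have gc i p q : A p -> A q -> coord i p = coord i q -> coord i (g p) = coord i (g q).
  move=> Ap Aq; rewrite -[p]/(val (SigSub (mem_set Ap) : A)).
  by rewrite -[q]/(val (SigSub (mem_set Aq) : A)) !gE; exact: fP.
case: (Arigid g) => [|gid|[c Ac gcst]].
- split.
  + move=> p Ap; rewrite -[p]/(val (SigSub (mem_set Ap) : A)) gE; exact: set_valP.
  + exact: (gc (@Ordinal 3 0 isT)).
  + exact: (gc (@Ordinal 3 1 isT)).
  + exact: (gc (@Ordinal 3 2 isT)).
- by left; apply: funext => p; apply: val_inj; rewrite -gE gid //; exact: set_valP.
- right; exists (SigSub (mem_set Ac)); apply: funext => p; apply: val_inj.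
  by rewrite -gE gcst //; exact: set_valP.
Qed.

(** * Homotheties along a strip of triangles *)

Definition homothety (l : R) (t p : R * R) : R * R := (t.1 + l * p.1, t.2 + l * p.2).

Definition strip (n : nat) (b : bool) : R * R := (INR n, if b then 1 else 0).

(** Column by column, bottom first: any two of three consecutive points agree in abscissa, ordinate
    or coordinate sum. *)
Definition zigzag (k : nat) : R * R := strip k./2 (odd k).

Lemma zigzag_inj : injective zigzag.
Proof.
move=> k m [/INR_eq h o]; rewrite -(odd_double_half k) -(odd_double_half m) h.
by case: (odd k) (odd m) o => -[] //= ?; exfalso; lra.
Qed.

(** The first two images share their abscissa, so their height difference is the only ratio left
    free. Each later point agrees with its two predecessors in two different ones of abscissa,
    ordinate and sum, which fixes its image. *)
Lemma homothety_on_zigzag (A : set (R * R)) f (m : nat) :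
  plane_map A f -> (forall k, (k < m)%N -> A (zigzag k)) ->
  forall k, (k < m)%N ->
    f (zigzag k) =
      homothety ((f (zigzag 1)).2 - (f (zigzag 0)).2) (f (zigzag 0)) (zigzag k).
Proof.
move=> [_ fx fy fs] Am.
set l := _ - _; set t := f (zigzag 0).
suff pair n : ((n.*2 < m)%N -> f (strip n false) = homothety l t (strip n false)) /\
              ((n.*2.+1 < m)%N -> f (strip n true) = homothety l t (strip n true)).
  move=> k; have [h0 h1] := pair k./2; rewrite -{1}(odd_double_half k) /zigzag.
  by case: (odd k); [exact: h1 | exact: h0].
have A0 k : (k.*2 < m)%N -> A (strip k false).
  by move=> /Am; rewrite /zigzag doubleK odd_double.
have A1 k : (k.*2.+1 < m)%N -> A (strip k true).
  by move=> /Am; rewrite /zigzag /= uphalf_double odd_double.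
elim: n => [|n [ih0 ih1]].
  split=> h; first by rewrite /homothety /= !Rmult_0_r !Rplus_0_r -surjective_pairing.
  have := fx (strip 0 true) (strip 0 false) (A1 0%N h) (A0 0%N (ltnW h)) erefl.
  move=> e; rewrite [f (strip 0 true)]surjective_pairing e /homothety /=.
  by congr pair; rewrite /l /t /zigzag /=; lra.
have eS : INR n.+1 = INR n + 1 by rewrite S_INR.
have ihS : (n.+1.*2 < m)%N ->
    f (strip n.+1 false) = homothety l t (strip n.+1 false).
  move=> h; have h1 : (n.*2.+1 < m)%N by exact: ltnW.
  have h0 := ltnW h1.
  have := fy (strip n.+1 false) (strip n false) (A0 n.+1 h) (A0 n h0) erefl.
  have := fs (strip n.+1 false) (strip n true) (A0 n.+1 h) (A1 n h1).
  rewrite ih0 // ih1 // /strip /= -/(INR n.+1) eS => /(_ ltac:(lra)) e1 e2.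
  rewrite [f _]surjective_pairing /homothety /=; congr pair; lra.
split=> // h; have h0 := ltnW h.
have h1 : (n.*2.+1 < m)%N by exact: ltnW (ltnW h).
have := fx (strip n.+1 true) (strip n.+1 false) (A1 n.+1 h) (A0 n.+1 h0) erefl.
have := fy (strip n.+1 true) (strip n true) (A1 n.+1 h) (A1 n h1) erefl.
rewrite ihS // ih1 // => e1 e2.
rewrite [f (strip n.+1 true)]surjective_pairing e1 e2 /homothety /=.
by [].
Qed.

Lemma homothety1 p : homothety 1 (0, 0) p = p.
Proof. by case: p => x y; rewrite /homothety /=; congr pair; lra. Qed.

Lemma homothety0 t p : homothety 0 t p = t.
Proof. by case: t => x y; rewrite /homothety /=; congr pair; lra. Qed.

Lemma plane_rigid_of_homothety (A : set (R * R)) : A (0, 0) ->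
  (forall f, plane_map A f -> exists l t, (forall p, A p -> f p = homothety l t p) /\
    (l = 0 \/ l = 1 /\ t = (0, 0))) ->
  plane_rigid A.
Proof.
move=> A0 h f fA; have [l [t [fE [l0|[l1 t0]]]]] := h f fA; last first.
  by left=> p Ap; rewrite fE // l1 t0 homothety1.
right; exists (f (0, 0)) => [|p Ap]; first by case: fA => + _ _ _; exact.
by rewrite !fE // l0 !homothety0.
Qed.

(** * Finite configurations *)

Lemma triangle_rigid : plane_rigid (zigzag @` `I_3).
Proof.
have Az k : (k < 3)%N -> (zigzag @` `I_3) (zigzag k) by move=> k3; exists k.
apply: plane_rigid_of_homothety => [|f fA]; first by exact: (Az 0%N).
have := homothety_on_zigzag _ _ _ fA Az; set l := _ - _ => lE.
exists l, (f (zigzag 0)); split=> [p [k k3 <-]|]; first exact: lE.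
have coords p : (zigzag @` `I_3) p -> p.1 = 0 /\ (p.2 = 0 \/ p.2 = 1) \/ p.1 = 1 /\ p.2 = 0.
  by move=> [[|[|[|k]]] // _ <-] /=; lra.
have [fAA _ _ _] := fA; have fz k (k3 : (k < 3)%N) := coords _ (fAA _ (Az k k3)).
have := fz 0%N isT; have := fz 1%N isT; have := fz 2%N isT.
rewrite (lE 1%N isT) (lE 2%N isT) /=; case: (f _) => t1 t2 /= h2 h1 h0.
have : l = 0 \/ l = 1 /\ t1 = 0 /\ t2 = 0.
  by case: h0 => [[? []?]|[? ?]]; case: h1 => [[? []?]|[? ?]];
    case: h2 => [[? []?]|[? ?]]; lra.
by move=> [|[? [-> ->]]]; [left | right].
Qed.

(** With [(0, 2)] added, column 0 is the only one with three points, so neither a half-turn nor a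
    nontrivial translation maps the set into itself. *)
Lemma flagged_strip_rigid (m : nat) : (3 < m)%N ->
  plane_rigid (zigzag @` `I_m `|` [set (0, 2)]).
Proof.
move=> m3; set A := (X in plane_rigid X).
have Az k : (k < m)%N -> A (zigzag k) by move=> km; left; exists k.
have A2 : A (0, 2) by right.
have m0 : (0 < m)%N by exact: leq_trans m3.
have m1 : (1 < m)%N by exact: leq_trans m3.
have m2 : (2 < m)%N by exact: leq_trans m3.
apply: plane_rigid_of_homothety => [|f fA]; first by exact: (Az 0%N).
have := homothety_on_zigzag _ _ _ fA Az; set l := _ - _ => lE.
have [fAA fx fy fs] := fA.
have fE p : A p -> f p = homothety l (f (zigzag 0)) p.
  move=> [[k km <-]|->]; first exact: lE.
  have := fx _ _ A2 (Az 0%N m0) erefl.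
  (* A fourth strip point is needed: [zigzag 3] is (1, 1), on the antidiagonal of (0, 2). *)
  have := fs _ _ A2 (Az 3%N m3) ltac:(rewrite /=; lra).
  rewrite (lE 3%N m3) [f (0, 2)]surjective_pairing /homothety /=.
  by case: (f _) => x y; case: (f _) => t1 t2 /= ? ?; congr pair; lra.
exists l, (f (zigzag 0)); split=> //.
have coords p : A p -> 0 <= p.1 /\ (p.2 = 0 \/ p.2 = 1 \/ p.1 = 0 /\ p.2 = 2).
  move=> [[k _ <-]|-> /=]; last by lra.
  by split; [exact: pos_INR | rewrite /=; case: (odd k); lra].
have := coords _ (fAA _ (Az 0%N m0)); have := coords _ (fAA _ (Az 1%N m1)).
have := coords _ (fAA _ (Az 2%N m2)); have := coords _ (fAA _ A2).
rewrite (lE 1%N m1) (lE 2%N m2) (fE _ A2) /=.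
case: (f _) => t1 t2 /= [? h3] [? h2] [? h1] [? h0].
have : l = 0 \/ l = 1 /\ t1 = 0 /\ t2 = 0.
  by case: h0 => [?|[?|[? ?]]]; case: h1 => [?|[?|[? ?]]];
    case: h2 => [?|[?|[? ?]]]; case: h3 => [?|[?|[? ?]]]; lra.
by move=> [|[? [-> ->]]]; [left | right].
Qed.

(** * Bounded additive functions on Z + Z s *)

Definition lattice (s : R) : set R := [set x | exists i j : Z, x = IZR i + IZR j * s].

Lemma latticeD s x y : lattice s x -> lattice s y -> lattice s (x + y).
Proof.
move=> [i [j ->]] [k [n ->]]; exists (i + k)%Z, (j + n)%Z.
by rewrite !plus_IZR; lra.
Qed.

Lemma latticeB s x y : lattice s x -> lattice s y -> lattice s (x - y).
Proof.
move=> [i [j ->]] [k [n ->]]; exists (i - k)%Z, (j - n)%Z.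
by rewrite !minus_IZR; lra.
Qed.

Lemma lattice_IZR s i : lattice s (IZR i).
Proof. by exists i, 0%Z; lra. Qed.

Lemma lattice_gen s : lattice s s.
Proof. by exists 0%Z, 1%Z; lra. Qed.

(** Multiples of a nonzero [a x] would exceed [M]. This is meant for the deviation of a plane map
    from a homothety, which is additive only while sums stay in the unit interval. *)
Lemma bounded_additive_eq0 (s M : R) (a : R -> R) :
  (forall x y, lattice s x -> lattice s y -> 0 <= x -> 0 <= y -> x + y <= 1 ->
    a (x + y) = a x + a y) ->
  a 1 = 0 -> (forall x, lattice s x -> 0 <= x <= 1 -> Rabs (a x) <= M) ->
  forall x, lattice s x -> 0 <= x <= 1 -> a x = 0.
Proof.
move=> aD a1 aM x sx x01.
have s0 := lattice_IZR s 0; have s1 := lattice_IZR s 1.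
have a0 : a 0 = 0.
  by have := aD 0 0 s0 s0; rewrite Rplus_0_l => /(_ ltac:(lra) ltac:(lra) ltac:(lra)); lra.
(* Reducing n x modulo 1 keeps a unchanged, as a 1 = 0, so the multiples of a x
   are all values of a on the unit interval. *)
have wrap n : exists z, [/\ lattice s z, 0 <= z <= 1 & a z = INR n * a x].
  elim: n => [|n [y [sy y01 ay]]]; first by exists 0; split; rewrite ?a0 /=; try lra.
  rewrite S_INR.
  have [yx|yx] := Rle_or_lt (y + x) 1.
    exists (y + x); split; [exact: latticeD | lra |].
    by rewrite aD //; lra.
  (* When [y + x] passes 1, adding [1 - y] to [y] and to [y + x - 1] stays within the unit interval
     and links [a y] to [a (y + x - 1)]. *)
  have sy' := latticeB _ _ _ s1 sy; have sz := latticeB _ _ _ (latticeD _ _ _ sy sx) s1.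
  exists (y + x - 1); split=> //; first by lra.
  have := aD y (1 - y) sy sy' ltac:(lra) ltac:(lra) ltac:(lra).
  have := aD (y + x - 1) (1 - y) sz sy' ltac:(lra) ltac:(lra) ltac:(lra).
  by replace (y + (1 - y)) with 1 by lra; replace (y + x - 1 + (1 - y)) with x by lra; lra.
have [//|ax0] := Req_dec (a x) 0.
have ax := Rabs_pos_lt _ ax0.
have [n nM] := INR_unbounded (M / Rabs (a x)).
have [z [sz z01 az]] := wrap n; have := aM z sz z01.
rewrite az Rabs_mult (Rabs_pos_eq _ (pos_INR n)).
have : M / Rabs (a x) * Rabs (a x) = M by field; lra.
by nra.
Qed.

(** * The infinite configuration *)

Definition filled_strip (S : set R) : set (R * R) :=
  range zigzag `|`
  [set p | exists2 s, S s &
    [/\ lattice s p.1, lattice s p.2, 0 <= p.1, 0 <= p.2 & p.1 + p.2 <= 1]].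

Lemma filled_strip_rigid (S : set R) (s0 : R) : S s0 -> 0 < s0 < 1 ->
  plane_rigid (filled_strip S).
Proof.
move=> Ss0 s01; set A := filled_strip S.
have Az k : A (zigzag k) by left; exists k.
have As n b : A (strip n b).
  have := Az (b + n.*2)%N; rewrite /zigzag half_bit_double.
  by rewrite oddD odd_double; case: b.
have At s x y : S s -> lattice s x -> lattice s y -> 0 <= x -> 0 <= y -> x + y <= 1 ->
    A (x, y) by move=> *; right; exists s.
apply: plane_rigid_of_homothety => [|f fA]; first exact: (Az 0%N).
have lE k := homothety_on_zigzag A f k.+1 fA (fun k _ => Az k) k (ltnSn k).
move: lE; set l := _ - _; set t := f (zigzag 0) => lE.
have fstrip n b : f (strip n b) = homothety l t (strip n b).
  have := lE (b + n.*2)%N; rewrite /zigzag half_bit_double.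
  by rewrite oddD odd_double; case: b.
have [fAA fx fy fs] := fA.
have Arange p : A p -> [/\ 0 <= p.1, 0 <= p.2 <= 1 &
    1 < p.1 -> exists n, p.1 = INR n /\ (p.2 = 0 \/ p.2 = 1)].
  move=> [[k _ <-]|[s _ [? ? ? ? ?]]]; last by split; lra.
  have e : (zigzag k).2 = 0 \/ (zigzag k).2 = 1.
    by rewrite /=; case: (odd k); [right | left].
  by split; [exact: pos_INR | lra | exists k./2].
have l1 : Rabs l <= 1.
  have [_ h1 _] := Arange _ (fAA _ (Az 1%N)).
  have [_ h0 _] := Arange _ (fAA _ (Az 0%N)).
  by apply: Rabs_le; rewrite /l; lra.
have fE p : A p -> f p = homothety l t p.
  move=> [[k _ <-]|[s Ss]]; first exact: lE.
  case: p => x y [/= sx sy x0 y0 xy].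
  have Z0 := lattice_IZR s 0.
  pose b z := (f (0, z)).2 - t.2.
  have Ax z : lattice s z -> 0 <= z <= 1 -> A (z, 0).
    by move=> sz z01; apply: (At s) => //; lra.
  have Ay z : lattice s z -> 0 <= z <= 1 -> A (0, z).
    by move=> sz z01; apply: (At s) => //; lra.
  (* The sum relation between (0, z) and (z, 0) makes [b] describe abscissas as well as
     ordinates. *)
  have fb z w : lattice s z -> lattice s w -> 0 <= z -> 0 <= w -> z + w <= 1 ->
      f (z, w) = (t.1 + b z, t.2 + b w).
    move=> sz sw z0 w0 zw.
    have Azw : A (z, w) by exact: (At s).
    have h1 := fx (z, w) (z, 0) Azw (Ax z sz ltac:(lra)) erefl.
    have h2 := fy (z, w) (0, w) Azw (Ay w sw ltac:(lra)) erefl.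
    have h3 := fs (z, 0) (0, z) (Ax z sz ltac:(lra)) (Ay z sz ltac:(lra)) ltac:(rewrite /=; lra).
    have h4 := fy (z, 0) (zigzag 0) (Ax z sz ltac:(lra)) (Az 0%N) erefl.
    have h5 := fx (0, z) (zigzag 0) (Ay z sz ltac:(lra)) (Az 0%N) erefl.
    rewrite [f (z, w)]surjective_pairing /b; congr pair; rewrite /t; lra.
  suff bl z : lattice s z -> 0 <= z <= 1 -> b z = l * z.
    by rewrite fb // !bl //; lra.
  move=> sz z01.
  suff : (fun w => b w - l * w) z = 0 by lra.
  (* Additivity comes from the equal sums of [(u, v)] and [(u + v, 0)]. The bound 2 is 1 for [b], a
     difference of ordinates in [0, 1], plus 1 for [l * w]. *)
  apply: (bounded_additive_eq0 s 2 (fun w => b w - l * w) _ _ _ z sz z01).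
  - move=> u v su sv u0 v0 uv.
    have suv := latticeD _ _ _ su sv.
    have := fs (u, v) (u + v, 0) (At s u v Ss su sv u0 v0 uv) (Ax _ suv ltac:(lra))
      ltac:(rewrite /=; lra).
    by rewrite !fb //; try lra; rewrite /b /t /zigzag /strip /=; lra.
  - by have := fstrip 0%N true; rewrite /b /strip /homothety /= => -> /=; lra.
  - move=> u su u01.
    have [_ h1 _] := Arange _ (fAA _ (Ay u su u01)).
    have [_ h0 _] := Arange _ (fAA _ (Az 0%N)).
    have b1 : Rabs (b u) <= 1 by apply: Rabs_le; rewrite /b /t; lra.
    have lu1 : Rabs (l * u) <= 1.
      rewrite Rabs_mult (Rabs_pos_eq u); last by lra.
      by have := Rabs_pos l; nra.
    by have := Rabs_triang (b u) (- (l * u)); rewrite Rabs_Ropp /Rminus; lra.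
exists l, t; split=> //.
have [t1 tt _] := Arange _ (fAA _ (Az 0%N)).
have fn n b : A (t.1 + l * INR n, t.2 + l * (if b then 1 else 0)).
  by rewrite -[(_, _)]/(homothety l t (strip n b)) -fstrip; apply: fAA.
have [l0|[l0|l0]] : l = 0 \/ l < 0 \/ 0 < l by lra.
- by left.
- have [n nl] := INR_unbounded (t.1 / (- l)).
  have [/= h _ _] := Arange _ (fn n false).
  have : t.1 / (- l) * (- l) = t.1 by field; lra.
  by nra.
right.
(* Both points of column [n] go beyond abscissa 1, where ordinates are 0 or 1; as [l] is positive,
   [l = 1] and [t.2 = 0]. *)
have [n nl] := INR_unbounded (1 / l).
have lt1 : 1 < l * INR n.
  have : 1 / l * l = 1 by field; lra.
  by nra.
have [_ _ /= h] := Arange _ (fn n false); have [|m [_ m0]] := h; first by rewrite -/t in t1; lra.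
have [_ _ /= {}h] := Arange _ (fn n true); have [|k [_ k0]] := h; first by rewrite -/t in t1; lra.
have [el et] : l = 1 /\ t.2 = 0 by lra.
split=> //.
suff : t.1 = 0 by move: et; case: (t) => /= ? ? -> ->.
have [//|t1'] : t.1 = 0 \/ 0 < t.1 by rewrite -/t in t1; lra.
exfalso.
(* The image of (1, 0) has integral abscissa at least 2, so that of (s0, 0) also lies beyond 1 and
   is integral; yet they differ by [1 - s0]. *)
have [_ _ /= {}h] := Arange _ (fn 1%N false); have [|i [ei _]] := h; first by lra.
have As0 : A (s0, 0).
  by apply: (At s0) => //; [exact: lattice_gen | exact: (lattice_IZR _ 0) | lra | lra | lra].
have := fAA _ As0; rewrite fE // el /homothety /= => /Arange [_ _ /=] {}h.
rewrite el /= in ei.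
have i2 : 2 <= INR i.
  have : INR 1 < INR i by rewrite /=; lra.
  by move=> /INR_lt i1; apply: (le_INR 2); lia.
have [|j [ej _]] := h; first by lra.
have ij : (INR j < INR i) by lra.
have ji : (INR i < INR j.+1) by rewrite S_INR; lra.
by move: ij ji => /INR_lt ? /INR_lt ?; lia.
Qed.

(** * Cardinalities of the configurations *)

Lemma card_filled_strip (K : Type) (s : K -> R) :
  infinite_set [set: K] -> injective s -> (forall k, 0 < s k < 1) ->
  filled_strip (range s) #= [set: K].
Proof.
move=> Kinf sinj s01; apply/card_eqPle; split; last first.
  apply/card_leT_injP; exists (fun k => (s k, 0)) => [k m [/sinj]//|k].
  right; exists (s k); first by exists k.
  have := s01 k; split=> /=; try lra; [exact: lattice_gen | exact: (lattice_IZR _ 0)].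
(* An index and four integers code a point, hence so does an element of [K * nat], and
   [infinite_prod_nat_le] absorbs the factor [nat]. *)
pose point k (c : Z * Z * Z * Z) :=
  let: (i, j, m, n) := c in (IZR i + IZR j * s k, IZR m + IZR n * s k).
pose decode (q : K * nat) := if unpickle q.2 is Some c then point q.1 c else (0, 0).
apply: (card_le_trans _ (infinite_prod_nat_le _ Kinf)).
apply: (card_le_trans _ (card_image_le decode setT)); apply: subset_card_le => p pA.
suff [k [c ->]] : exists k c, p = point k c.
  have <- : decode (k, pickle c) = point k c by rewrite /decode [unpickle _]pickleK.
  exact: imageP.
case: pA => [[n _ <-]|[_ [k _ <-] [[i [j e1]] [m [n e2]] _ _ _]]]; last first.
  by exists k, (i, j, m, n); rewrite [p]surjective_pairing e1 e2.
have [k _] := infinite_setN0 Kinf.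
exists k, (Z.of_nat n./2, 0%Z, if odd n then 1%Z else 0%Z, 0%Z).
rewrite /zigzag /strip /point INR_IZR_INZ; congr pair; first by lra.
by case: (odd n); lra.
Qed.

Lemma card_zigzag (m : nat) : zigzag @` `I_m #= `I_m.
Proof. by apply: inj_card_eq => k n _ _ /zigzag_inj. Qed.

Lemma card_flagged_strip (m : nat) : zigzag @` `I_m `|` [set (0, 2)] #= `I_m.+1.
Proof.
pose g k := if k is n.+1 then zigzag n else (0, 2).
suff -> : zigzag @` `I_m `|` [set (0, 2)] = g @` `I_m.+1.
  apply: inj_card_eq => -[|k] [|n] _ _ //=.
  - by move=> /(congr1 snd) /=; case: (odd n) => ?; exfalso; lra.
  - by move=> /(congr1 snd) /=; case: (odd k) => ?; exfalso; lra.
  - by move=> /zigzag_inj ->.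
apply/seteqP; split=> [p [[k km <-]|->]|p [[|k] km <-]].
- by exists k.+1.
- by exists 0%N.
- by right.
- by left; exists k.
Qed.

End Plane.

(** * Passage to the given cardinal *)

Lemma semirigid_of_card (K : Type) (A : set (R * R)) :
  A #= [set: K] -> plane_rigid A ->
  exists (E : Type) (rho : 'I_3 -> E -> E -> Prop),
    [set: E] #= [set: K] /\ equivalence_system rho /\ semirigid rho.
Proof.
move=> AK /semirigid_of_plane_rigid [rho rhoP].
by exists A, rho; split=> //; rewrite (card_eql (card_setT A)).
Qed.

Theorem theorem9p4 (K : Type)
    (hK2 : ~ ([set: K] #= `I_2)) (hK4 : ~ ([set: K] #= `I_4))
    (hKc : [set: K] #<= [set: nat -> bool]) :
  exists (E : Type) (rho : 'I_3 -> E -> E -> Prop),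
    [set: E] #= [set: K] /\ equivalence_system rho /\ semirigid rho.
Proof.
have [[n Kn]|Kinf] := pselect (finite_set [set: K]); last first.
  have /card_leT_injP [i iinj _] := hKc.
  have [F [Finj F01]] := nat_bool_embeds_R.
  apply: (semirigid_of_card K (filled_strip (range (F \o i)))).
    by apply: card_filled_strip => // [x y /Finj /iinj //|k]; exact: F01.
  have [k _] := infinite_setN0 Kinf.
  by apply: (filled_strip_rigid _ (F (i k))) => //; exists k.
have nK A : A #= `I_n -> plane_rigid A -> exists (E : Type) (rho : 'I_3 -> E -> E -> Prop),
    [set: E] #= [set: K] /\ equivalence_system rho /\ semirigid rho.
  by move=> An; apply: semirigid_of_card; apply: card_eq_trans An _; rewrite card_eq_sym.
(* On at most one point every self-map is the identity, so three copies of equality suffice. *)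
have [n1|n1] := leqP n 1.
  have K1 (x y : K) : x = y.
    have /card_leT_injP [g ginj gn] : [set: K] #<= `I_n by move/card_eqPle: Kn => [].
    apply: ginj; have := gn x; have := gn y; rewrite /mkset.
    by case: n n1 {Kn hK2 nK gn} => [|[]] // _; case: (g x) (g y) => [|?] [|?].
  exists K, (fun _ => eq); split; first exact: card_eqxx.
  split=> [i|f _]; first by split=> // x y z ->.
  by left; apply: funext => x; exact: K1.
(* Sizes 2 and 4 are excluded; size [n.+5] is [n.+4] strip points plus (0, 2). *)
case: n n1 Kn nK => [|[|[|[|[|n]]]]] // _ Kn nK.
- exact: nK (card_zigzag 3) triangle_rigid.
- exact: nK (card_flagged_strip n.+4) (flagged_strip_rigid n.+4 isT).
Qed.
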